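(* Let $\lambda=(\lambda_1,\dots,\lambda_K)\in\Lambda$. Then the flexible queueing network is rate stable under the scheduling algorithm specified by the update $$p^{n+1}=\big[p^n+\beta^n\,\tilde E^n(I-R^T)^{-1}\Delta Q^{n+1}\big]_{\mathcal C_{\varepsilon_0}},$$ that is, $$\lim_{n\to\infty}\frac{Q^n_k}{n}=0\quad\text{almost surely, for all }1\le k\le K.$$
   Context: Network. There are $K$ queues and $J$ servers. $\mathcal S_k\neq\emptyset$ is the set of servers able to serve queue $k$, and $\mathcal T_j=\{k:j\in\mathcal S_k\}\ne\emptyset$. For $j\in\mathcal S_k$ the service rate is $\mu_{kj}=\mu_k\alpha_j$ with finite $\mu_k,\alpha_j>0$, and (after scaling time) $\sum_{j\in\mathcal S_k}\mu_{kj}p_{kj}<1$ for every $k$ and every feasible $(p_{kj})$ (i.e. $p_{kj}\ge0$, $\sum_{k\in\mathcal T_j}p_{kj}\le1$ for all $j$). Exogenous arrivals to queue $k$ have rate $\lambda_k\in[0,1]$. $R=[r_{k'k}]$ is the $K\times K$ routing matrix: $r_{k'k}\ge0$ is the probability that a task completing service at queue $k'$ joins queue $k$ ($\sum_kr_{k'k}\le1$; with the remaining probability it leaves). The network is open: $I-R^T$ is invertible. Nominal rates: $\nu=(I-R^T)^{-1}\lambda$; it is assumed that $\nu_k>0$ for all $k$. Capacity region. $\Lambda$ is the set of $\lambda\in\mathbb R_+^K$ for which there exist $p_{kj}\ge0$ with $\sum_{k\in\mathcal T_j}p_{kj}\le1$ for all $j$ and $\nu_k\le\sum_{j\in\mathcal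 S_k}\mu_{kj}p_{kj}$ for all $k$. Dynamics (discrete time $n=0,1,2,\dots$). Queue lengths $Q^n_k$ are non-negative integers with arbitrary deterministic initial values, and $$Q^{n+1}_k=Q^n_k+a^n_k+\sum_{k'=1}^Kd^n_{k'}\mathbf 1^n_{k'\to k}-d^n_k,\qquad \Delta Q^{n+1}=Q^{n+1}-Q^n ,$$ where $a^n_k\in\{0,1\}$ is the number of exogenous arrivals, $d^n_k=s^n_k\mathbf 1_{\{Q^n_k>0\}}$ the number of departures from queue $k$, and $\mathbf 1^n_{k'\to k}$ the indicator that a task leaving queue $k'$ at time $n$ goes to queue $k$ (at most one $k$ for each $k'$, $n$). Conditionally on the history up to time $n$ (all queue lengths and allocation vectors at times $\le n$), the $a^n_k$, the $s^n_k$ and the routing decisions from the different queues are independent, with $a^n_k$ Bernoulli($\lambda_k$), $s^n_k$ Bernoulli($\mu_kp^n_k$), and $\mathbf 1^n_{k'\to k}$ Bernoulli($r_{k'k}$). Policy. $p_k=\sum_{j\in\mathcal S_k}\alpha_jp_{kj}$ is the total capacity allocated to queue $k$. $\mathcal C$ is the set of $p\in\mathbb R^K$ for which there exist $p_{kj}\ge0$ with $\sum_{j\in\mathcal S_k}\alpha_jp_{kj}=p_k$ for all $k$ and $\sum_{k\in\mathcal T_j}p_{kj}\le1$ for all $j$. Fix $\varepsilon_0>0$ with $\nu_k/\mu_k\ge\varepsilon_0$ for all $k$, and let $\mathcal C_{\varepsilon_0}=\{p\in\mathcal C:p_k\ge\varepsilon_0\ \forall k\}$; $[x]_{\mathcal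 C_{\varepsilon_0}}$ is Euclidean projection onto $\mathcal C_{\varepsilon_0}$. $\tilde E^n$ is the $K\times K$ diagonal matrix with $\tilde E^n_{kk}=\mathbf 1_{\{Q^n_k>0\}}$. $(\beta^n)$ is a positive decreasing sequence with $\sum_n\beta^n=\infty$, $\sum_n(\beta^n)^2<\infty$, and $\lim_{n\to\infty}\frac1{n\beta^n}$ existing and finite. The initial vector $p^0\in\mathcal C$ is arbitrary. *)

(* Defs.v *)
From HB Require Import structures.
From mathcomp Require Export all_boot all_order all_algebra.
From mathcomp Require Export all_classical all_reals all_analysis.
Export numFieldNormedType.Exports.

Set Implicit Arguments.
Unset Strict Implicit.
Unset Printing Implicit Defensive.

Import Order.TTheory GRing.Theory Num.Theory.

Local Open Scope classical_set_scope.
Local Open Scope ring_scope.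

Section Conditioning.
Context (R : realType) (d : measure_display) (T : measurableType d).
Variable P : probability T R.

(* Y is a version of the conditional probability P(A | G). *)
Definition is_cond_prob (G : set (set T)) (A : set T) (Y : T -> R) : Prop :=
  [/\ forall B : set R, measurable B -> G (Y @^-1` B),
      P.-integrable setT (EFin \o Y) &
      forall H, G H -> (\int[P]_(w in H) (Y w)%:E = P (A `&` H))%E].

(* Mutual independence, conditionally on G, of the sigma-algebras F i: for all
   A_i in F i, P(\bigcap_i A_i | G) = \prod_i P(A_i | G). Subfamilies are
   covered by taking A_i := setT. *)
Definition cond_indep (G : set (set T)) (I : finType) (F : I -> set (set T)) :
    Prop :=
  forall (A : I -> set T) (Y : I -> T -> R),
    (forall i, F i (A i)) -> (forall i, is_cond_prob G (A i) (Y i)) ->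
    is_cond_prob G (\bigcap_i A i) (fun w => \prod_i Y i w).

End Conditioning.

Section Projection.
Context (R : realType) (K : nat).

(* The library norm on matrices is the sup norm. *)
Definition enorm (x : 'cV[R]_K) : R := Num.sqrt (\sum_k x k 0 ^+ 2).

Definition is_eproj (C : set 'cV[R]_K) (x y : 'cV[R]_K) : Prop :=
  C y /\ forall z, C z -> enorm (x - y) <= enorm (x - z).

End Projection.

(* q k j is the fraction of its capacity that server j allocates to queue k;
   only the entries with j \in S k are meaningful. *)
Definition feasible (R : realType) (K J : nat) (S : 'I_K -> {set 'I_J})
    (q : 'M[R]_(K, J)) : Prop :=
  (forall k j, 0 <= q k j) /\ (forall j, \sum_(k | j \in S k) q k j <= 1).

Record network (R : realType) (K J : nat) := Network {
  servers : 'I_K -> {set 'I_J};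
  mu : 'I_K -> R;
  alpha : 'I_J -> R;
  routing : 'M[R]_K;  (* routing k' k: probability of going from k' to k *)
  servers_neq0 : forall k, exists j, j \in servers k;
  served_neq0 : forall j, exists k, j \in servers k;
  mu_gt0 : forall k, 0 < mu k;
  alpha_gt0 : forall j, 0 < alpha j;
  rate_lt1 : forall q, feasible servers q ->
    forall k, \sum_(j in servers k) mu k * alpha j * q k j < 1;
  routing_ge0 : forall k' k, 0 <= routing k' k;
  routing_le1 : forall k', \sum_k routing k' k <= 1;
  routing_open : 1%:M - routing^T \in unitmx
}.

Section Network.
Context (R : realType) (K J : nat).
Variable N : network R K J.

Definition nominal (lambda : 'cV[R]_K) : 'cV[R]_K :=
  invmx (1%:M - (routing N)^T) *m lambda.

Definition capacity_region : set 'cV[R]_K :=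
  [set lambda : 'cV[R]_K | (forall k, 0 <= lambda k 0) /\
    exists2 q, feasible (servers N) q &
      forall k, nominal lambda k 0 <=
        \sum_(j in servers N k) mu N k * alpha N j * q k j].

Definition alloc_set : set 'cV[R]_K :=
  [set p : 'cV[R]_K | exists2 q, feasible (servers N) q &
    forall k, \sum_(j in servers N k) alpha N j * q k j = p k 0].

Definition alloc_set_ge (eps0 : R) : set 'cV[R]_K :=
  [set p : 'cV[R]_K | alloc_set p /\ forall k, eps0 <= p k 0].

End Network.

Record process (R : realType) (K : nat) (d : measure_display)
    (T : measurableType d) (P : probability T R) := Process {
  Q : nat -> 'I_K -> {RV P >-> nat};
  arrival : nat -> 'I_K -> {RV P >-> bool};
  service : nat -> 'I_K -> {RV P >-> bool};
  (* route n k' k: a task leaving queue k' at time n goes to queue k *)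
  route : nat -> 'I_K -> 'I_K -> {RV P >-> bool};
  alloc : nat -> 'I_K -> {RV P >-> R}
}.

Section Process.
Context (R : realType) (K J : nat) (d : measure_display) (T : measurableType d).
Variables (P : probability T R) (N : network R K J) (X : process K P).

Definition departure (n : nat) (k : 'I_K) (w : T) : bool :=
  service X n k w && (0 < Q X n k w)%N.

Definition allocv (n : nat) (w : T) : 'cV[R]_K := \col_k alloc X n k w.

Definition deltaQ (n : nat) (w : T) : 'cV[R]_K :=
  \col_k ((Q X n.+1 k w)%:R - (Q X n k w)%:R).

Definition Etilde (n : nat) (w : T) : 'M[R]_K :=
  diag_mx (\row_k (0 < Q X n k w)%N%:R).

Definition history (n : nat) : set (set T) :=
  <<s [set A | exists m k, (m <= n)%N /\
        (g_sigma_algebra_preimage (Q X m k) A \/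
         g_sigma_algebra_preimage (alloc X m k) A)] >>.

(* One sigma-algebra for each arrival, each service, and each routing decision
   (the latter is the whole row of indicators out of a given queue). *)
Definition step_sigma (n : nat) (i : 'I_K + 'I_K + 'I_K) : set (set T) :=
  match i with
  | inl (inl k) => g_sigma_algebra_preimage (arrival X n k)
  | inl (inr k) => g_sigma_algebra_preimage (service X n k)
  | inr k' => <<s \bigcup_k g_sigma_algebra_preimage (route X n k' k) >>
  end.

Definition queue_dynamics : Prop :=
  [/\ forall k, exists q0, forall w, Q X 0 k w = q0,
      forall n k' w k1 k2, route X n k' k1 w -> route X n k' k2 w -> k1 = k2 &
      forall n k w, (Q X n.+1 k w)%:Z =
        (Q X n k w)%:Z + (arrival X n k w)%:Z
        + \sum_k' (departure n k' w * route X n k' k w)%N%:Z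
        - (departure n k w)%:Z].

Definition step_law (lambda : 'cV[R]_K) : Prop :=
  forall n,
  [/\ cond_indep P (history n) (step_sigma n),
      forall k, is_cond_prob P (history n)
        [set w | arrival X n k w] (cst (lambda k 0)),
      forall k, is_cond_prob P (history n)
        [set w | service X n k w] (fun w => mu N k * alloc X n k w) &
      forall k' k, is_cond_prob P (history n)
        [set w | route X n k' k w] (cst (routing N k' k))].

Definition scheduling (beta : nat -> R) (eps0 : R) : Prop :=
  (exists2 p0, alloc_set N p0 & forall w, allocv 0 w = p0) /\
  forall n w, is_eproj (alloc_set_ge N eps0)
    (allocv n w + beta n *:
      (Etilde n w *m invmx (1%:M - (routing N)^T) *m deltaQ n w))
    (allocv n.+1 w).

Definition rate_stable : Prop :=
  forall k, {ae P, forall w, (Q X n k w)%:R / n%:R @[n --> \oo] --> (0 : R)}.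

End Process.

Definition step_sizes (R : realType) (beta : nat -> R) : Prop :=
  [/\ forall n, 0 < beta n,
      nonincreasing_seq beta,
      series beta @ \oo --> +oo,
      cvgn (series (fun n => beta n ^+ 2)) &
      cvgn (fun n => (n%:R * beta n)^-1)].

(* Main.v *)
Require Import Defs.
From mathcomp Require Import measurable_realfun ring lra.

(* Write p*_k = nu_k / mu_k, a point of C_eps0 because lambda is in the capacity
   region. The increment (1 - R^T)^-1 Delta Q has conditional mean
   nu_k - mu_k p_k on busy queues, so the projected update is a stochastic
   gradient step, and taking expectations in |p^(n+1) - p*|^2 gives
   sum_n beta^n E(sum_k 1{Q_k > 0} mu_k (p_k - p*_k)^2) < oo.
   As 1/n = O(beta^n), Kronecker's lemma and Cauchy-Schwarz yield
   sum_(m < n) 1{Q_k > 0} (p_k - p*_k) = o(n) almost surely, and the martingale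
   part of the workload U = (1 - R^T)^-1 Q is o(n) by orthogonality. Hence
   U_k = o(n) + nu_k (idle time of queue k), and Q = (1 - R^T) U; since the idle
   time grows only when Q_k = 0 and R is substochastic, it is itself o(n). *)

Set Implicit Arguments.
Unset Strict Implicit.
Unset Printing Implicit Defensive.

Import Order.TTheory GRing.Theory Num.Theory.

Local Open Scope classical_set_scope.
Local Open Scope ring_scope.

(** * Sublinear sequences *)

Section Sublinear.
Context {R : realType}.
Implicit Types (x y f g : nat -> R).

(** This is x n = o(n). The additive constant replaces a threshold on [n], so that bounds hold for
    every [n] and add up directly. *)
Definition sublinear x :=
  forall e, 0 < e -> exists C, forall n, `|x n| <= e * n%:R + C.

Lemma sublinear_le x y : (forall n, `|x n| <= `|y n|) -> sublinear y ->
  sublinear x.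
Proof.
move=> xy ys e e0; have [C hC] := ys e e0; exists C => n.
exact: le_trans (xy n) (hC n).
Qed.

Lemma sublinear_cst (c : R) : sublinear (fun=> c).
Proof.
move=> e e0; exists `|c| => n.
by rewrite lerDr mulr_ge0 // ltW.
Qed.

Lemma sublinearD x y : sublinear x -> sublinear y ->
  sublinear (fun n => x n + y n).
Proof.
move=> hx hy e e0; have e20 : 0 < e / 2 by lra.
have [C hC] := hx _ e20; have [D hD] := hy _ e20; exists (C + D) => n.
by apply: le_trans (ler_normD _ _) _; have := hC n; have := hD n; lra.
Qed.

Lemma sublinearZ (c : R) x : sublinear x -> sublinear (fun n => c * x n).
Proof.
move=> hx e e0; have c0 : 0 < `|c| + 1 by rewrite ltr_wpDl.
have [C hC] := hx _ (divr_gt0 e0 c0); exists ((`|c| + 1) * C) => n.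
rewrite normrM (@le_trans _ _ ((`|c| + 1) * `|x n|)) ?ler_wpM2r ?lerDl//.
rewrite (le_trans (ler_wpM2l (ltW c0) (hC n)))// le_eqVlt; apply/orP; left.
by apply/eqP; field; lra.
Qed.

Lemma sublinear_sum (I : finType) (F : I -> nat -> R) :
  (forall i, sublinear (F i)) -> sublinear (fun n => \sum_i F i n).
Proof.
move=> hF; elim: (index_enum I) => [|i s ih].
  by apply: sublinear_le (sublinear_cst 0) => n; rewrite big_nil.
apply: sublinear_le (sublinearD (hF i) ih) => n.
by rewrite big_cons.
Qed.

Lemma sublinear_cvg x : sublinear x -> x n / n%:R @[n --> \oo] --> (0 : R).
Proof.
move=> hx; apply/cvgrPdist_le => e e0.
have e20 : 0 < e / 2 by lra.
have [C hC] := hx _ e20.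
have C0 : 0 <= C by have := hC 0%N; rewrite mulr0 add0r; apply: le_trans.
near=> n.
have n0 : 0 < n%:R :> R by rewrite ltr0n; near: n; exists 1%N.
have hn : C / (e / 2) <= n%:R.
  by near: n; exact: nbhs_infty_ger.
rewrite sub0r normrN normrM normfV (gtr0_norm n0) ler_pdivrMr//.
rewrite ler_pdivrMr// in hn.
by have := hC n; lra.
Unshelve. all: by end_near. Qed.

(** The partial sums are nondecreasing and bounded; [N] is an index at which they come within [e] of
    their supremum. *)
Lemma sum_tail_small f (B : R) : (forall n, 0 <= f n) ->
  (forall n, \sum_(m < n) f m <= B) ->
  forall e, 0 < e -> exists N, forall m n, (N <= m)%N ->
    \sum_(i < n) f i <= \sum_(i < m) f i + e.
Proof.
move=> f0 fB e e0; pose A := range (fun n => \sum_(m < n) f m).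
have supA : has_sup A.
  by split; [exists (\sum_(m < 0) f m), 0%N|exists B => _ [n _ <-]].
have [_ [N _ <-] hN] := sup_adherent e0 supA.
exists N => m n Nm.
have hm : \sum_(i < N) f i <= \sum_(i < m) f i.
  rewrite -!(big_mkord xpredT f) (big_cat_nat (leq0n N) Nm)/= lerDl.
  exact: sumr_ge0.
have : \sum_(i < n) f i <= sup A by apply: sup_upper_bound => //; exists n.
by move: hN hm; lra.
Qed.

Lemma sum_term_small f (B : R) : (forall n, 0 <= f n) ->
  (forall n, \sum_(m < n) f m <= B) ->
  forall e, 0 < e -> exists N, forall n, (N <= n)%N -> f n <= e.
Proof.
move=> f0 fB e e0; have [N hN] := sum_tail_small f0 fB e0.
exists N => n Nn; have := hN n n.+1 Nn.
by rewrite big_ord_recr/=; lra.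
Qed.

(* Kronecker's lemma; the weights need only be at least of order 1/n. *)
Lemma sublinear_sum_weighted (beta g : nat -> R) (B c : R) : 0 < c ->
  (forall n, (0 < n)%N -> 1 <= c * (n%:R * beta n)) ->
  (forall n, 0 <= g n) -> (forall n, 0 <= beta n) ->
  (forall n, \sum_(m < n) beta m * g m <= B) ->
  sublinear (fun n => \sum_(m < n) g m).
Proof.
move=> c0 hbeta g0 b0 hB e e0.
have f0 n : 0 <= beta n * g n by rewrite mulr_ge0.
have [N hN] := sum_tail_small f0 hB (divr_gt0 e0 c0).
(* The maximum with 1 keeps the indices from [M] on positive, where the lower bound on [beta] is
   available. *)
pose M := maxn N 1; exists (\sum_(m < M) g m) => n.
rewrite ger0_norm ?sumr_ge0//.
have [nM|Mn] := leqP n M.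
  rewrite -!(big_mkord xpredT g) (big_cat_nat (leq0n n) nM)/=.
  rewrite addrCA lerDl addr_ge0 ?sumr_ge0//.
  by rewrite mulr_ge0// ltW.
(* For k <= n the weight bound gives g k <= c n (beta k) (g k). Summed from [M] to [n], the right
   side is at most n c (e / c) = e n. *)
suff H k : (M <= k <= n)%N -> \sum_(m < k) g m <= \sum_(m < M) g m +
    n%:R * c * (\sum_(m < k) beta m * g m - \sum_(m < M) beta m * g m).
  have := H n; rewrite (ltnW Mn) leqnn => /(_ isT) /le_trans; apply.
  rewrite addrC lerD2r.
  have := hN M n (leq_maxl _ _); rewrite -lerBlDl => /(ler_wpM2l _) => h.
  rewrite (le_trans (h (n%:R * c) _))//; first by rewrite mulr_ge0// ltW.
  by rewrite le_eqVlt; apply/orP; left; apply/eqP; field; lra.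
elim: k => [|k ih] /andP[].
  by rewrite /M; case: (N) => [|?]//; rewrite maxnE.
rewrite leq_eqVlt => /predU1P[<- _|Mk kn]; first by rewrite subrr mulr0 addr0.
rewrite !big_ord_recr/= (le_trans (lerD (ih _) (lexx _)))//.
  by rewrite -ltnS Mk ltnW.
have k0 : (0 < k)%N by rewrite (leq_trans _ (Mk : (M <= k)%N))// leq_max orbT.
have kn' : k%:R <= n%:R :> R by rewrite ler_nat ltnW.
have h1 : g k <= c * (k%:R * beta k) * g k by rewrite ler_peMl// hbeta.
have h2 : c * (k%:R * beta k) * g k <= c * (n%:R * beta k) * g k.
  by rewrite ler_wpM2r// ler_pM2l// ler_wpM2r.
by move: h1 h2; lra.
Qed.

(** With t = e / 2, each term satisfies |x| <= t + x^2 / t. Taking slope t^2 for the squares leaves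
    slope t after division, hence 2 t = e in all. *)
Lemma sublinear_sum_sqr x : sublinear (fun n => \sum_(m < n) x m ^+ 2) ->
  sublinear (fun n => \sum_(m < n) x m).
Proof.
move=> hx e e0; have e20 : 0 < e / 2 by lra.
have [C hC] := hx _ (mulr_gt0 e20 e20).
exists (C / (e / 2)) => n.
have h m : `|x m| <= e / 2 + x m ^+ 2 / (e / 2).
  rewrite -(ler_pM2l e20) mulrDr [X in _ + X]mulrCA divff ?lt0r_neq0// mulr1.
  rewrite -(real_normK (num_real (x m))).
  by have := sqr_ge0 (`|x m| - e / 2); have := sqr_ge0 (`|x m|); nra.
rewrite (le_trans (ler_norm_sum _ _ _))//.
rewrite (le_trans (ler_sum _ (fun (m : 'I_n) _ => h m)))//.
rewrite big_split/= sumr_const card_ord -mulr_suml.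
have := hC n; rewrite ger0_norm ?sumr_ge0// => [|i _]; last exact: sqr_ge0.
rewrite -(ler_pM2r (_ : 0 < (e / 2)^-1)) ?invr_gt0//.
move=> /(lerD (lexx (e / 2 *+ n))) /le_trans; apply.
rewrite -mulr_natr le_eqVlt; apply/orP; left; apply/eqP; field; lra.
Qed.

Lemma sqrn_bracket n : exists r, (r ^ 2 <= n < r.+1 ^ 2)%N.
Proof.
have h0 : exists r, (r ^ 2 <= n)%N by exists 0%N.
have hM r : (r ^ 2 <= n)%N -> (r <= n)%N.
  by case: r => // r; apply: leq_trans; rewrite leq_pmulr.
have [r hr hmax] := ex_maxnP h0 hM; exists r; rewrite hr ltnNge.
by apply/negP => /hmax; rewrite ltnn.
Qed.

(** The terms of a bounded nonnegative series tend to 0, which controls [S] along the squares. From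
    r^2 to below (r + 1)^2 there are at most 2 r steps, so [S] moves by at most 2 r C, which is of
    order sqrt n. *)
Lemma sublinear_squares (S : nat -> R) (C B : R) : S 0%N = 0 ->
  (forall n, `|S n.+1 - S n| <= C) ->
  (forall n, \sum_(r < n) (S (r.+1 ^ 2)%N / (r.+1 ^ 2)%:R) ^+ 2 <= B) ->
  sublinear S.
Proof.
move=> S0 SC SB e e0; have e20 : 0 < e / 2 by lra.
have C0 : 0 <= C := le_trans (normr_ge0 _) (SC 0%N).
have [N hN] := sum_term_small
  (fun n => sqr_ge0 (S (n.+1 ^ 2)%N / (n.+1 ^ 2)%:R)) SB (mulr_gt0 e20 e20).
have incr m k : `|S (m + k)%N - S m| <= k%:R * C.
  elim: k => [|k ih]; first by rewrite addn0 subrr normr0 mul0r.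
  have -> : S (m + k.+1)%N - S m = (S (m + k).+1 - S (m + k)%N) +
     (S (m + k)%N - S m) by rewrite addnS; ring.
  rewrite (le_trans (ler_normD _ _))//.
  by have := SC (m + k)%N; rewrite -natr1; move: ih; lra.
(* The first summand covers the indices below (N + 1)^2; the second is the remainder of the
   inequality [amgm] below. *)
exists (C * (N.+1 ^ 2)%:R + C ^+ 2 / (e / 2)) => n.
have c2 : 0 <= C ^+ 2 / (e / 2) by rewrite divr_ge0 ?sqr_ge0 // ltW.
have [nN|Nn] := ltnP n (N.+1 ^ 2)%N.
  have := incr 0%N n; rewrite add0n S0 subr0 => /le_trans; apply.
  have : n%:R <= (N.+1 ^ 2)%:R :> R by rewrite ler_nat ltnW.
  move=> /(ler_wpM2r C0); have : 0 <= e * n%:R by rewrite mulr_ge0// ltW.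
  lra.
have [r /andP[rn nr]] := sqrn_bracket n.
have Nr : (N < r)%N.
  by rewrite -ltnS -(ltn_sqr N.+1) (leq_ltn_trans Nn).
case: r Nr rn nr => // r Nr rn nr.
have Sr : `|S (r.+1 ^ 2)%N| <= e / 2 * (r.+1 ^ 2)%:R.
  have : `|S (r.+1 ^ 2)%N / (r.+1 ^ 2)%:R| <= e / 2.
    rewrite -(@ler_pXn2r _ 2)// ?nnegrE ?(ltW e20)// real_normK ?num_real//.
    exact: hN.
  by rewrite normrM normfV normr_nat ler_pdivrMr// ltr0n expn_gt0.
have := incr (r.+1 ^ 2)%N (n - r.+1 ^ 2)%N; rewrite subnKC// => hincr.
have hk : (n - r.+1 ^ 2)%:R <= 2 * r.+1%:R :> R.
  rewrite -natrM ler_nat leq_subLR -ltnS (leq_trans nr)//.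
  by rewrite -[r.+2]addn1 sqrnD muln1 exp1n addn1 addSn.
have hr2 : r.+1%:R ^+ 2 <= n%:R :> R by rewrite -natrX ler_nat.
have -> : S n = (S n - S (r.+1 ^ 2)%N) + S (r.+1 ^ 2)%N by ring.
rewrite (le_trans (ler_normD _ _))//.
have amgm : 2 * r.+1%:R * C <= e / 2 * r.+1%:R ^+ 2 + C ^+ 2 / (e / 2).
  rewrite -(ler_pM2l e20) mulrDr [e / 2 * (C ^+ 2 / _)]mulrCA.
  rewrite divff ?lt0r_neq0// mulr1.
  by have := sqr_ge0 (e / 2 * r.+1%:R - C); lra.
have h1 := ler_wpM2r C0 hk; have h2 := ler_wpM2l (ltW e20) hr2.
rewrite natrX in Sr.
have : 0 <= C * (N.+1 ^ 2)%:R by rewrite mulr_ge0.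
lra.
Qed.

End Sublinear.

(** * Reflection *)

Section Reflection.
Context {R : realType} {K : nat}.
Variables (A : 'M[R]_K) (nu : 'I_K -> R) (q W Y : 'I_K -> nat -> R).
Hypotheses (A0 : forall i j, 0 <= A i j) (A1 : forall i, \sum_j A i j <= 1)
  (Aunit : 1%:M - A^T \in unitmx) (nu0 : forall k, 0 <= nu k)
  (Y0 : forall k, Y k 0%N = 0)
  (YS : forall k n, Y k n.+1 = Y k n + nu k * (q k n == 0)%:R)
  (qE : forall k n, q k n = W k n + Y k n - \sum_i A i k * (W i n + Y i n)).

Lemma regulator_ndecr k m n : (m <= n)%N -> Y k m <= Y k n.
Proof.
move: m n; apply/nondecreasing_seqP => n.
by rewrite YS lerDl mulr_ge0.
Qed.

Lemma regulator_ge0 k n : 0 <= Y k n.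
Proof. by rewrite -(Y0 k) regulator_ndecr. Qed.

(* Y k has last increased when q k was 0, which gives its value then. *)
Lemma regulator_le (w : R) n :
  (forall k m, (m <= n)%N -> `|W k m| <= w) ->
  forall k, Y k n <= K.+1%:R * w + nu k + \sum_i A i k * Y i n.
Proof.
move=> hw k.
have w0 : 0 <= w := le_trans (normr_ge0 _) (hw k 0%N (leq0n n)).
suff H m : (m <= n)%N -> Y k m <= K.+1%:R * w + nu k + \sum_i A i k * Y i n.
  exact: H.
have S0 : 0 <= \sum_i A i k * Y i n.
  by apply: sumr_ge0 => i _; rewrite mulr_ge0 ?regulator_ge0.
elim: m => [_|m ih mn].
  by rewrite Y0 !addr_ge0 ?mulr_ge0.
rewrite YS; case: eqVneq => [q0|_]; last by rewrite mulr0 addr0 ih// ltnW.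
rewrite mulr1 addrAC lerD2r.
(* As [q k m] vanishes, [qE] can be solved for [Y k m]. The increment [nu k] made at this step has
   already been cancelled against the one in the bound. *)
have -> : Y k m = - W k m + \sum_i A i k * W i m + \sum_i A i k * Y i m.
  have := qE k m; rewrite q0; under eq_bigr do rewrite mulrDr.
  by rewrite big_split/=; lra.
have hAY : \sum_i A i k * Y i m <= \sum_i A i k * Y i n.
  by apply: ler_sum => i _; rewrite ler_wpM2l// regulator_ndecr// ltnW.
have hWk : - W k m <= w by rewrite (le_trans (ler_norm _))// normrN hw// ltnW.
(* This is a column sum of [A], while [A1] bounds row sums; bounding each entry by 1 costs the
   factor [K]. *)
suff hAW : \sum_i A i k * W i m <= K%:R * w by rewrite -natr1; lra.
have -> : K%:R * w = \sum_(i < K) w by rewrite sumr_const card_ord mulr_natl.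
apply: ler_sum => i _.
have Aik : A i k <= 1.
  by apply: le_trans (A1 i); rewrite (bigD1 k)//= lerDl sumr_ge0.
have := hw i m (ltnW mn); rewrite ler_norml => /andP[_ h].
by have := A0 i k; nra.
Qed.

(* The slack b := c + nu - (1 - A^T) Y is nonnegative with total mass at most
   K c + sum nu, because A is substochastic and Y >= 0; this bounds
   Y = (1 - A^T)^-1 (c + nu - b). *)
Lemma regulator_bound (c : R) n : 0 <= c ->
  (forall k, Y k n <= c + nu k + \sum_i A i k * Y i n) ->
  forall k, Y k n <=
    (\sum_i `|invmx (1%:M - A^T) k i|) * (K%:R * c + \sum_i nu i).
Proof.
move=> c0 hY k.
pose b i := c + nu i + \sum_j A j i * Y j n - Y i n.
have b0 i : 0 <= b i by rewrite subr_ge0 hY.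
have sb : \sum_i b i <= K%:R * c + \sum_i nu i.
  rewrite /b !big_split/= sumr_const card_ord mulr_natl.
  rewrite -addrA gerDl sumrN subr_le0 exchange_big/=.
  apply: ler_sum => i _; rewrite -mulr_suml.
  by rewrite ler_piMl// regulator_ge0.
(* Both c + nu i and b i lie between 0 and the right side. The existence of the index [i] gives K >=
   1, hence c <= K c. *)
have bi i : `|c + nu i - b i| <= K%:R * c + \sum_i nu i.
  have b1 : b i <= \sum_i b i by rewrite (bigD1 i)//= lerDl sumr_ge0.
  have n1 : nu i <= \sum_i nu i by rewrite (bigD1 i)//= lerDl sumr_ge0.
  have c1 : c <= K%:R * c by rewrite ler_peMl// ler1n (leq_trans _ (ltn_ord i)).
  have := b0 i; have := nu0 i; rewrite ler_norml; lra.
have YE : \col_i Y i n = invmx (1%:M - A^T) *m \col_i (c + nu i - b i).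
  rewrite -[LHS](mulKmx Aunit); congr (_ *m _).
  apply/colP => i; rewrite mulmxBl mul1mx !mxE /b.
  under eq_bigr do rewrite !mxE.
  ring.
have -> : Y k n = (\col_i Y i n) k 0 by rewrite mxE.
rewrite YE mxE (le_trans (ler_norm _))// (le_trans (ler_norm_sum _ _ _))//.
rewrite mulr_suml; apply: ler_sum => i _.
by rewrite mxE normrM ler_wpM2l.
Qed.

(** For each horizon [n], a uniform bound on [W] up to [n] bounds [Y] at [n] linearly, so [Y]
    inherits sublinearity; [q] is a linear combination of [W] and [Y]. *)
Lemma reflected_sublinear : (forall k, sublinear (W k)) ->
  forall k, sublinear (q k).
Proof.
move=> hW.
have hY k : sublinear (Y k).
  move=> e e0; pose g := \sum_i `|invmx (1%:M - A^T) k i|.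
  have g0 : 0 <= g by apply: sumr_ge0.
  (* The product is the factor by which the two regulator bounds amplify the size of [W]; adding 1
     keeps [M] positive. *)
  pose M := g * K%:R * K.+1%:R + 1.
  have M0 : 0 < M by rewrite ltr_wpDl// !mulr_ge0.
  have /choice[C hC] i : exists C, forall n, `|W i n| <= e / M * n%:R + C.
    exact: (hW i _ (divr_gt0 e0 M0)).
  have C0 i : 0 <= C i.
    by have := hC i 0%N; rewrite mulr0 add0r; apply: le_trans.
  exists (g * K%:R * K.+1%:R * \sum_i C i + g * \sum_i nu i) => n.
  rewrite ger0_norm ?regulator_ge0//.
  have hw i m : (m <= n)%N -> `|W i m| <= e / M * n%:R + \sum_i C i.
    move=> mn; rewrite (le_trans (hC i m))// lerD//.
      by rewrite ler_wpM2l ?ler_nat// divr_ge0 ?ltW.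
    by rewrite (bigD1 i)//= lerDl sumr_ge0.
  have w0 := le_trans (normr_ge0 _) (hw k 0%N (leq0n n)).
  have c0 : 0 <= K.+1%:R * (e / M * n%:R + \sum_i C i) by rewrite mulr_ge0.
  have := regulator_bound c0 (regulator_le hw) k; rewrite -/g => /le_trans.
  apply; rewrite !mulrDr !addrA lerD2r !mulrA lerD2r.
  apply: ler_wpM2r => //; rewrite ler_pdivrMr// [leRHS]mulrC.
  apply: ler_wpM2r; first exact: ltW.
  by rewrite /M lerDl.
move=> k.
have hWY i : sublinear (fun n => W i n + Y i n) by exact: sublinearD.
have h := sublinearD (hWY k) (sublinearZ (-1)
  (sublinear_sum (fun i => sublinearZ (A i k) (hWY i)))).
by apply: sublinear_le h => n; rewrite qE mulN1r.
Qed.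

End Reflection.

(** * Bounded random variables *)

Section BoundedMeasurable.
Context {d : measure_display} {T : measurableType d} {R : realType}.
Implicit Types f g : T -> R.

(** This class is an algebra whose members are all integrable under a probability, so expectations
    can be manipulated without separate integrability proofs. *)
Definition bounded_meas f :=
  measurable_fun setT f /\ exists C, forall w, `|f w| <= C.

Lemma bounded_meas_cst (c : R) : bounded_meas (fun=> c).
Proof. by split; [exact: measurable_cst|exists `|c|]. Qed.

Lemma bounded_measD f g : bounded_meas f -> bounded_meas g ->
  bounded_meas (fun w => f w + g w).
Proof.
move=> [mf [C hC]] [mg [D hD]]; split; first exact: measurable_funD.
by exists (C + D) => w; rewrite (le_trans (ler_normD _ _)) ?lerD.
Qed.

Lemma bounded_measM f g : bounded_meas f -> bounded_meas g ->
  bounded_meas (fun w => f w * g w).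
Proof.
move=> [mf [C hC]] [mg [D hD]]; split; first exact: measurable_funM.
by exists (C * D) => w; rewrite normrM ler_pM.
Qed.

Lemma bounded_measZ (c : R) f : bounded_meas f ->
  bounded_meas (fun w => c * f w).
Proof. exact/bounded_measM/bounded_meas_cst. Qed.

Lemma bounded_measB f g : bounded_meas f -> bounded_meas g ->
  bounded_meas (fun w => f w - g w).
Proof.
move=> hf hg; have := bounded_measD hf (bounded_measZ (-1) hg).
by under eq_fun do rewrite mulN1r.
Qed.

Lemma bounded_measX f n : bounded_meas f ->
  bounded_meas (fun w => f w ^+ n).
Proof.
move=> hf; elim: n => [|n ih]; first exact: bounded_meas_cst.
by under eq_fun do rewrite exprS; exact: bounded_measM.
Qed.

Lemma bounded_meas_sum (I : Type) (s : seq I) (F : I -> T -> R) :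
  (forall i, bounded_meas (F i)) -> bounded_meas (fun w => \sum_(i <- s) F i w).
Proof.
move=> hF; elim: s => [|i s ih].
  by under eq_fun do rewrite big_nil; exact: bounded_meas_cst.
by under eq_fun do rewrite big_cons; exact: bounded_measD.
Qed.

Lemma bounded_meas_indic (A : set T) : measurable A ->
  bounded_meas (\1_A : T -> R).
Proof.
move=> mA; split; first exact: measurable_indic.
by exists 1 => w; rewrite indicE normr_nat lern1 leq_b1.
Qed.

End BoundedMeasurable.

(** * Expectations of bounded variables *)

Section Expectation.
Context {d : measure_display} {T : measurableType d} {R : realType}.
Variable P : probability T R.
Implicit Types f g : T -> R.

Local Notation E f := (\int[P]_w f w).

Lemma bounded_meas_integrable f : bounded_meas f ->
  P.-integrable setT (EFin \o f).
Proof.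
move=> [mf [C hC]]; apply: measurable_bounded_integrable => //.
  exact: le_lt_trans (probability_le1 P measurableT) (ltry _).
exists C; split; first exact: num_real.
by move=> x Cx w _; exact: le_trans (hC w) (ltW Cx).
Qed.

Lemma meanD f g : bounded_meas f -> bounded_meas g ->
  E (fun w => f w + g w) = E f + E g.
Proof. by move=> hf hg; rewrite RintegralD//;
  exact: bounded_meas_integrable. Qed.

Lemma meanB f g : bounded_meas f -> bounded_meas g ->
  E (fun w => f w - g w) = E f - E g.
Proof. by move=> hf hg; rewrite RintegralB//;
  exact: bounded_meas_integrable. Qed.

Lemma meanZ (c : R) f : bounded_meas f -> E (fun w => c * f w) = c * E f.
Proof. by move=> hf; rewrite RintegralZl//; exact: bounded_meas_integrable. Qed.

Lemma mean_cst (c : R) : E (fun=> c) = c.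
Proof.
rewrite Rintegral_cst// [X in fine X](_ : _ = 1%E) ?mulr1//.
exact: probability_setT.
Qed.

Lemma mean_sum (I : Type) (s : seq I) (F : I -> T -> R) :
  (forall i, bounded_meas (F i)) ->
  E (fun w => \sum_(i <- s) F i w) = \sum_(i <- s) E (F i).
Proof.
move=> hF; elim: s => [|i s ih].
  rewrite big_nil -[RHS](mean_cst 0).
  by apply: eq_Rintegral => w _; rewrite big_nil.
rewrite big_cons -ih -meanD//; last exact: bounded_meas_sum.
by apply: eq_Rintegral => w _; rewrite big_cons.
Qed.

Lemma mean_le f g : bounded_meas f -> bounded_meas g ->
  (forall w, f w <= g w) -> E f <= E g.
Proof. by move=> hf hg fg; apply: le_Rintegral => //;
  exact: bounded_meas_integrable. Qed.

Lemma mean_norm_le f (C : R) : bounded_meas f -> (forall w, `|f w| <= C) ->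
  `|E f| <= C.
Proof.
move=> hf hC; have hC' w : - C <= f w <= C by rewrite -ler_norml.
rewrite ler_norml; apply/andP; split.
  rewrite -(mean_cst (- C)); apply: mean_le => // [|w].
    exact: bounded_meas_cst.
  by case/andP: (hC' w).
rewrite -[leRHS](mean_cst C); apply: mean_le => // [|w].
  exact: bounded_meas_cst.
by case/andP: (hC' w).
Qed.

(** By monotone convergence the full series has expectation at most [B], so it is almost surely
    finite and bounds its own partial sums. *)
Lemma ae_bounded_sum (f : nat -> T -> R) (B : R) :
  (forall n, bounded_meas (f n)) -> (forall n w, 0 <= f n w) ->
  (forall n, \sum_(m < n) E (f m) <= B) ->
  {ae P, forall w, exists B', forall n, \sum_(m < n) f m w <= B'}.
Proof.
move=> hf f0 fB.
pose F w := (\sum_(n <oo) (f n w)%:E)%E.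
have F0 w : (0 <= F w)%E by apply: nneseries_ge0 => n _ _; rewrite lee_fin.
have mf n : measurable_fun setT (EFin \o f n).
  by apply/measurable_EFinP; case: (hf n).
have intF : (\int[P]_w F w <= B%:E)%E.
  rewrite integral_nneseries//=; last by move=> n w _; rewrite lee_fin.
  apply: lime_le; first by apply: is_cvg_nneseries => n _ _;
    apply: integral_ge0 => w _; rewrite lee_fin.
  apply: nearW => n; rewrite big_mkord.
  rewrite (eq_bigr (fun m : 'I_n => (E (f m))%:E)) => [|m _].
    by rewrite sumEFin lee_fin; exact: fB.
  rewrite /Rintegral fineK//; apply: integrable_fin_num => //.
  exact: bounded_meas_integrable (hf m).
have iF : P.-integrable setT F.
  apply/integrableP; split.
    apply: (@ge0_emeasurable_sum _ _ _ _ _ xpredT) => [k w _ _|k _].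
      by rewrite lee_fin.
    exact: mf.
  under eq_integral do rewrite gee0_abs//.
  by rewrite (le_lt_trans intF)// ltry.
have := integrable_ae measurableT iF; apply: filterS => w /(_ I) Fw.
exists (fine (F w)) => n; rewrite -lee_fin fineK// -sumEFin.
rewrite -(big_mkord xpredT (fun m => (f m w)%:E)).
by apply: nneseries_lim_ge => m _ _; rewrite lee_fin.
Qed.

End Expectation.

(** * Conditionally centred variables *)

(** The count is the integer part of [x], written as a sum of indicators. *)
Lemma count_thresholds {R : realType} (M : nat) (x : R) : 0 <= x <= M%:R ->
  \sum_(i < M) (i.+1%:R <= x)%R%:R <= x <= \sum_(i < M) (i.+1%:R <= x)%R%:R + 1.
Proof.
case/andP => x0 xM.
(* For the induction on [M] the bound on [x] moves into the clauses; the third says that the count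
   saturates once [x] reaches [M]. *)
suff : [/\ \sum_(i < M) (i.+1%:R <= x)%R%:R <= x :> R,
    (x <= M%:R -> x <= \sum_(i < M) (i.+1%:R <= x)%R%:R + 1) &
    (M%:R <= x -> \sum_(i < M) (i.+1%:R <= x)%R%:R = M%:R :> R)].
  by case=> h1 h2 _; rewrite h1 h2.
elim: M {xM} => [|M [h1 h2 h3]].
  by rewrite big_ord0; split=> // h; lra.
rewrite big_ord_recr/=; case: (leP (M.+1%:R) x) => [Mx|xM].
  have Mx' : M%:R <= x by rewrite (le_trans _ Mx)// ler_nat.
  by rewrite h3//= -natr1 in Mx *; split=> //; lra.
rewrite addr0; split=> //.
move=> _; have [|Mx] := leP x M%:R; first exact: h2.
by rewrite (h3 (ltW Mx)) natr1 ltW.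
Qed.

Section SubSigmaAlgebra.
Context {d : measure_display} {T : measurableType d} {R : realType}.
Variable P : probability T R.
Implicit Types (f g Z : T -> R) (G : set (set T)).

Local Notation E f := (\int[P]_w f w).

Definition bounded_meas_wrt G Z := @bounded_meas _ (g_sigma_algebraType G) R Z.

(* f has conditional expectation 0 given <<s G>>. *)
Definition cond_mean0 G f :=
  bounded_meas f /\
  forall Z, bounded_meas_wrt G Z -> E (fun w => Z w * f w) = 0.

Section Fixed.
Variable G : set (set T).
Hypothesis sG : <<s G >> `<=` @measurable _ T.

Lemma bounded_meas_wrtW Z : bounded_meas_wrt G Z -> bounded_meas Z.
Proof.
move=> [mZ bZ]; split => // _ B mB; rewrite setTI; apply: sG.
by have := mZ measurableT B mB; rewrite setTI.
Qed.

Lemma cond_mean0D f g : cond_mean0 G f -> cond_mean0 G g ->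
  cond_mean0 G (fun w => f w + g w).
Proof.
move=> [bf hf] [bg hg]; split => [|Z hZ]; first exact: bounded_measD.
have bZ := bounded_meas_wrtW hZ.
under eq_Rintegral do rewrite mulrDr.
by rewrite meanD ?hf ?hg ?addr0//; exact: bounded_measM.
Qed.

Lemma cond_mean0_sum (I : Type) (s : seq I) (F : I -> T -> R) :
  (forall i, cond_mean0 G (F i)) -> cond_mean0 G (fun w => \sum_(i <- s) F i w).
Proof.
move=> hF; elim: s => [|i s ih].
  under eq_fun do rewrite big_nil.
  split=> [|Z _]; first exact: bounded_meas_cst.
  by under eq_Rintegral do rewrite mulr0; exact: mean_cst.
by under eq_fun do rewrite big_cons; exact: cond_mean0D.
Qed.

Lemma cond_mean0M Z f : bounded_meas_wrt G Z -> cond_mean0 G f ->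
  cond_mean0 G (fun w => Z w * f w).
Proof.
move=> hZ [bf hf]; split=> [|Y hY].
  exact: bounded_measM (bounded_meas_wrtW hZ) bf.
by under eq_Rintegral do rewrite mulrA; apply: hf; exact: bounded_measM.
Qed.

Lemma cond_mean0Z (c : R) f : cond_mean0 G f -> cond_mean0 G (fun w => c * f w).
Proof. exact/cond_mean0M/bounded_meas_cst. Qed.

Lemma cond_mean0B f g : cond_mean0 G f -> cond_mean0 G g ->
  cond_mean0 G (fun w => f w - g w).
Proof.
move=> hf hg; have := cond_mean0D hf (cond_mean0Z (-1) hg).
by under eq_fun do rewrite mulN1r.
Qed.

(* Up to 1/N, a bounded function is a linear combination of the indicators of
   the sets {N (Z + C) >= i}. *)
Lemma cond_mean0_indic f : bounded_meas f ->
  (forall H, <<s G >> H -> E (fun w => \1_H w * f w) = 0) -> cond_mean0 G f.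
Proof.
move=> bf hf; split=> // Z hZ; have bZ := bounded_meas_wrtW hZ.
have [mZ [C hC]] := hZ; have [_ [D hD]] := bf.
have D0 : 0 <= D := le_trans (normr_ge0 _) (hD point).
have Ef : E f = 0.
  rewrite -[RHS](hf setT); last exact: (@measurableT _ (g_sigma_algebraType G)).
  by apply: eq_Rintegral => w _; rewrite indicE in_setT mul1r.
suff H N : `|E (fun w => Z w * f w)| <= N.+1%:R^-1 * D.
  apply/eqP; rewrite -normr_eq0 eq_le normr_ge0 andbT.
  apply/ler_addgt0Pr => e e0; rewrite add0r.
  have := H (Num.truncn (D / e)) => /le_trans; apply.
  rewrite mulrC ler_pdivrMr// mulrC -ler_pdivrMr// ltW//.
  by rewrite truncnS_gt.
(* Since Z + C lies in [0, 2 C], this many thresholds cover the range of (N + 1) (Z + C). *)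
pose M := (Num.truncn (N.+1%:R * (C + C))).+1.
pose A (i : 'I_M) := [set w | i.+1%:R <= N.+1%:R * (Z w + C)].
have sA i : <<s G >> (A i).
  have -> : A i = Z @^-1` `[N.+1%:R^-1 * i.+1%:R - C, +oo[.
    apply/seteqP; split => w /=; rewrite in_itv/= andbT lerBlDr.
      by rewrite ler_pdivrMl.
    by rewrite ler_pdivrMl.
  have := mZ measurableT _ (measurable_itv `[N.+1%:R^-1 * i.+1%:R - C, +oo[).
  by rewrite setTI.
have bA i : bounded_meas (\1_(A i) : T -> R).
  by apply: bounded_meas_indic; apply: sG.
(* [ZN] is [Z] with Z + C rounded down to the grid of mesh 1 / (N + 1). Its product with [f] has
   mean 0 by [hf] and, for the constant term, [Ef]. *)
pose ZN w := N.+1%:R^-1 * (\sum_(i < M) \1_(A i) w) - C.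
have bZN : bounded_meas ZN.
  apply: bounded_measB; last exact: bounded_meas_cst.
  by apply: bounded_measZ; exact: bounded_meas_sum.
have EZN : E (fun w => ZN w * f w) = 0.
  have -> : (fun w => ZN w * f w) = (fun w =>
      N.+1%:R^-1 * (\sum_(i < M) \1_(A i) w * f w) - C * f w).
    by apply/funext => w; rewrite /ZN mulrBl -mulrA mulr_suml.
  have bAf i : bounded_meas (fun w => \1_(A i) w * f w).
    exact: bounded_measM.
  rewrite meanB ?meanZ ?Ef ?mean_sum ?mulr0 ?subr0//.
  - by rewrite big1 ?mulr0// => i _; exact: hf.
  - exact: bounded_meas_sum.
  - by apply: bounded_measZ; exact: bounded_meas_sum.
  - exact: bounded_measZ.
rewrite -[X in `|X|]subr0 -EZN -meanB; [|exact: bounded_measM..].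
apply: mean_norm_le => [|w].
  by apply: bounded_measB; exact: bounded_measM.
rewrite -mulrBl normrM; apply: ler_pM => //.
have hx : 0 <= N.+1%:R * (Z w + C) <= M%:R.
  have := hC w; rewrite ler_norml => /andP[h1 h2].
  rewrite mulr_ge0//=; last by rewrite -lerBlDr sub0r.
  rewrite (le_trans _ (ltW (truncnS_gt _)))//.
  by apply: ler_wpM2l => //; rewrite lerD2r.
have := count_thresholds hx.
have hA (i : 'I_M) :
    (i.+1%:R <= N.+1%:R * (Z w + C))%R%:R = \1_(A i) w :> R.
  by rewrite indicE mem_setE.
under eq_bigr do rewrite hA.
move=> /andP[h1 h2].
have -> : Z w - ZN w = N.+1%:R^-1 *
    (N.+1%:R * (Z w + C) - \sum_(i < M) \1_(A i) w).
  by rewrite /ZN mulrBr mulrA mulVf// mul1r; ring.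
rewrite normrM gtr0_norm ?invr_gt0//.
rewrite ger0_norm ?subr_ge0// ler_piMr//.
by rewrite lerBlDl.
Qed.

(** It is enough to test against indicators of sets [H] of the sigma-algebra, and there the claim is
    the integral identity defining conditional probability. *)
Lemma cond_mean0_cond_prob (A : set T) (Y : T -> R) (C : R) : measurable A ->
  is_cond_prob P <<s G >> A Y -> (forall w, `|Y w| <= C) ->
  cond_mean0 G (fun w => \1_A w - Y w).
Proof.
move=> mA [mY iY hY] hC.
have bY : bounded_meas_wrt G Y.
  by split; [move=> _ B mB; rewrite setTI; exact: mY|exists C].
have bA := bounded_meas_indic (R := R) mA.
have bY' := bounded_meas_wrtW bY.
apply: cond_mean0_indic => [|H sH]; first exact: bounded_measB.
have mH : measurable H by exact: sG.
have bH := bounded_meas_indic (R := R) mH.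
under eq_Rintegral do rewrite mulrBr.
rewrite meanB; [|exact: bounded_measM..].
apply/eqP; rewrite subr_eq0; apply/eqP.
have -> : E (fun w => \1_H w * Y w) = \int[P]_(w in H) Y w.
  rewrite [RHS]Rintegral_mkcond; apply: eq_Rintegral => w _.
  by rewrite patchE indicE; case: ifP => _; rewrite ?mul1r ?mul0r.
rewrite /Rintegral hY//; congr fine.
rewrite setIC -[in RHS](setIT (H `&` A)) -integral_indic//;
  last exact: measurableI.
by apply: eq_integral => w _; rewrite indicI.
Qed.

End Fixed.

(* Orthogonality of the increments gives E S_n^2 <= C^2 n, so that the
   averages along the squares are a.s. square-summable; boundedness of the
   increments fills the gaps between consecutive squares. *)
Lemma martingale_sublinear (G : nat -> set (set T)) (xi : nat -> T -> R)
    (C : R) : (forall n, <<s G n >> `<=` @measurable _ T) ->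
  (forall n, cond_mean0 (G n) (xi n)) -> (forall n w, `|xi n w| <= C) ->
  (forall n, bounded_meas_wrt (G n) (fun w => \sum_(m < n) xi m w)) ->
  {ae P, forall w, sublinear (fun n => \sum_(m < n) xi m w)}.
Proof.
move=> sG xi0 xiC bS; pose S n w := \sum_(m < n) xi m w.
have bS' n : bounded_meas (S n) := bounded_meas_wrtW (sG n) (bS n).
have bxi n : bounded_meas (xi n) := (xi0 n).1.
have ES n : E (fun w => S n w ^+ 2) <= n%:R * C ^+ 2.
  elim: n => [|n ih].
    rewrite mul0r -[leRHS](mean_cst P 0) le_eqVlt; apply/orP; left; apply/eqP.
    by apply: eq_Rintegral => w _; rewrite /S big_ord0 expr0n.
  have -> : (fun w => S n.+1 w ^+ 2) =
      (fun w => S n w ^+ 2 + (2 * (S n w * xi n w) + xi n w ^+ 2)).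
    by apply/funext => w; rewrite /S big_ord_recr/=; ring.
  have b1 := bounded_measM (bS' n) (bxi n).
  have b2 := bounded_measX 2 (bxi n).
  have b3 := bounded_measZ 2 b1.
  rewrite meanD ?(meanD P b3 b2) ?meanZ//;
    [|exact: bounded_measX|exact: bounded_measD].
  (* The cross term vanishes because the partial sum is itself an admissible test variable. *)
  rewrite (xi0 n).2; last exact: bS.
  rewrite mulr0 add0r -natr1 mulrDl mul1r lerD//.
  rewrite -[leRHS](mean_cst P); apply: mean_le => // [|w].
    exact: bounded_meas_cst.
  by rewrite -real_normK ?num_real// lerXn2r ?nnegrE// (le_trans _ (xiC n w)).
pose f r w := (S (r.+1 ^ 2)%N w / (r.+1 ^ 2)%:R) ^+ 2.
have bf r : bounded_meas (f r).
  apply: bounded_measX; under eq_fun do rewrite mulrC.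
  exact: bounded_measZ.
have Ef r : E (f r) <= C ^+ 2 / (r.+1 ^ 2)%:R.
  have -> : f r = (fun w => ((r.+1 ^ 2)%:R ^+ 2)^-1 * S (r.+1 ^ 2)%N w ^+ 2).
    by apply/funext => w; rewrite /f expr_div_n mulrC.
  rewrite meanZ; last exact: bounded_measX.
  have r0 : 0 < (r.+1 ^ 2)%:R :> R by rewrite ltr0n expn_gt0.
  rewrite ler_pdivrMl ?exprn_gt0// (le_trans (ES _))// le_eqVlt.
  by apply/orP; left; apply/eqP; field; exact: lt0r_neq0.
have sumf n : \sum_(r < n) E (f r) <= 2 * C ^+ 2.
  (* The sharper bound makes the induction close: 1 / x^2 <= 2 / x - 2 / (x + 1) for x >= 1. *)
  suff : \sum_(r < n) E (f r) <= (2 - 2 * n.+1%:R^-1) * C ^+ 2.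
    move=> /le_trans; apply; rewrite ler_wpM2r ?sqr_ge0// gerBl.
    by rewrite mulr_ge0 ?invr_ge0.
  elim: n => [|n ih].
    by rewrite big_ord0 mulr_ge0 ?sqr_ge0// invr1; lra.
  rewrite big_ord_recr/= (le_trans (lerD ih (Ef n)))//.
  rewrite [C ^+ 2 / _]mulrC -mulrDl ler_wpM2r ?sqr_ge0//.
  have n1 : 1 <= n.+1%:R :> R by rewrite ler1n.
  rewrite natrX -[n.+2%:R]natr1; move: (n.+1%:R : R) n1 => x x1.
  rewrite -subr_ge0.
  have -> : 2 - 2 * (x + 1)^-1 - (2 - 2 * x^-1 + (x ^+ 2)^-1) =
    (x - 1) / (x ^+ 2 * (x + 1)) by field; lra.
  by rewrite divr_ge0 ?mulr_ge0 ?sqr_ge0//; lra.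
have := ae_bounded_sum bf (fun r w => sqr_ge0 _) sumf.
apply: filterS => w [B hB].
apply: (@sublinear_squares _ _ C B) => [|n|n]; first by rewrite big_ord0.
  by rewrite big_ord_recr/= addrAC subrr add0r.
exact: hB.
Qed.

End SubSigmaAlgebra.

(** * Allocations *)

Section EuclideanProjection.
Context {R : realType} {K : nat}.
Implicit Types (x y z : 'cV[R]_K) (C : set 'cV[R]_K).

Definition segment_closed C := forall x y (t : R), C x -> C y -> 0 <= t <= 1 ->
  C (x + t *: (y - x)).

(** The variational inequality (x - y, z - y) <= 0 holds at the projection; expanding |x - z|^2
    around [y] then leaves only nonnegative extra terms. *)
Lemma eproj_contract C x y z : segment_closed C -> is_eproj C x y -> C z ->
  \sum_k (y k 0 - z k 0) ^+ 2 <= \sum_k (x k 0 - z k 0) ^+ 2.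
Proof.
move=> cC [Cy hy] Cz.
pose ip := \sum_k (x k 0 - y k 0) * (z k 0 - y k 0).
pose s := \sum_k (z k 0 - y k 0) ^+ 2.
have s0 : 0 <= s by apply: sumr_ge0 => k _; exact: sqr_ge0.
(* Minimality of [y] is compared with the point y + t (z - y) of [C]. *)
have ipt t : 0 < t <= 1 -> 2 * ip <= t * s.
  move=> /andP[t0 t1].
  have := hy (y + t *: (z - y)); rewrite /enorm ler_sqrt; last first.
    by apply: sumr_ge0 => k _; exact: sqr_ge0.
  have -> : \sum_k (x - (y + t *: (z - y))) k 0 ^+ 2 =
     \sum_k (x - y) k 0 ^+ 2 - t * (2 * ip - t * s).
    rewrite /ip /s !mulr_sumr -sumrB mulr_sumr -sumrB.
    by apply: eq_bigr => k _; rewrite !mxE; ring.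
  rewrite lerBDl gerDr pmulr_rle0// subr_le0; apply.
  by apply: cC => //; rewrite t1 ltW.
have ip0 : ip <= 0.
  rewrite leNgt; apply/negP => ip_gt0.
  have h1 : 2 * ip <= s by rewrite -[s]mul1r ipt// ltr01 lexx.
  have s_gt0 : 0 < s by lra.
  (* If [ip] were positive, t = ip / s would be admissible by [h1] and would give 2 ip <= ip. *)
  have := ipt (ip / s); rewrite divfK ?lt0r_neq0// divr_gt0//.
  by rewrite ler_pdivrMr// mul1r; lra.
have -> : \sum_k (x k 0 - z k 0) ^+ 2 = \sum_k (y k 0 - z k 0) ^+ 2 +
    (\sum_k (x k 0 - y k 0) ^+ 2 - 2 * ip).
  rewrite /ip mulr_sumr -sumrB -big_split; apply: eq_bigr => k _ /=; ring.
rewrite lerDl subr_ge0 (@le_trans _ _ 0)//; first by lra.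
by apply: sumr_ge0 => k _; exact: sqr_ge0.
Qed.

End EuclideanProjection.

(** * Bounds, convexity and the nominal point of the allocation sets *)

Section Allocations.
Context {R : realType} {K J : nat} (N : network R K J).

Lemma alloc_set_bounds (p : 'cV[R]_K) : alloc_set N p ->
  forall k, 0 <= p k 0 <= \sum_j alpha N j.
Proof.
move=> [q [q0 q1] qp] k; rewrite -qp.
have aq j : 0 <= alpha N j * q k j by rewrite mulr_ge0// ltW// alpha_gt0.
rewrite sumr_ge0//= [leRHS](bigID (fun j => j \in servers N k))/=.
rewrite -[leLHS]addr0 lerD//; last first.
  by apply: sumr_ge0 => j _; rewrite ltW// alpha_gt0.
apply: ler_sum => j jk; rewrite ler_piMr ?(ltW (alpha_gt0 _ _))//.
rewrite (le_trans _ (q1 j))// (bigD1 k)//= lerDl.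
exact: sumr_ge0.
Qed.

Lemma alloc_set_ge_segment_closed (e : R) : segment_closed (alloc_set_ge N e).
Proof.
move=> x y t [[q [q0 q1] qx] xe] [[r [r0 r1] ry] ye] /andP[t0 t1].
have u0 : 0 <= 1 - t by rewrite subr_ge0.
split; last first.
  move=> k; rewrite !mxE.
  have := xe k; have := ye k; move: (x k 0) (y k 0) => a b h1 h2.
  by have := mulr_ge0 t0 (_ : 0 <= b - e); have := mulr_ge0 u0 (_ : 0 <= a - e);
    rewrite !subr_ge0 => /(_ h2) + /(_ h1); lra.
exists (\matrix_(k, j) ((1 - t) * q k j + t * r k j)); last first.
  move=> k; rewrite !mxE -qx -ry -sumrB mulr_sumr -big_split/=.
  by apply: eq_bigr => j _; rewrite !mxE; ring.
split=> [k j|j]; first by rewrite mxE addr_ge0 ?mulr_ge0.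
under eq_bigr do rewrite mxE.
rewrite big_split/= -!mulr_sumr.
have := ler_wpM2l u0 (q1 j); have := ler_wpM2l t0 (r1 j); lra.
Qed.

(** The capacity region provides at least the nominal capacity, whereas membership needs equality.
    Scaling row [k] of the allocation by p k / c k <= 1 achieves this and preserves feasibility. *)
Lemma nominal_alloc (lambda : 'cV[R]_K) (e : R) : 0 < e ->
  (forall k, e <= nominal N lambda k 0 / mu N k) -> capacity_region N lambda ->
  alloc_set_ge N e (\col_k (nominal N lambda k 0 / mu N k)).
Proof.
move=> e0 he [_ [q [q0 q1] qnu]]; split; last by move=> k; rewrite mxE.
pose p k := nominal N lambda k 0 / mu N k.
pose c k := \sum_(j in servers N k) alpha N j * q k j.
have pc k : p k <= c k.
  rewrite ler_pdivrMr ?mu_gt0// mulrC mulr_sumr (le_trans (qnu k))// le_eqVlt.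
  apply/orP; left; apply/eqP; apply: eq_bigr => j _; ring.
have p0 k : 0 < p k := lt_le_trans e0 (he k).
have c0 k : 0 < c k := lt_le_trans (p0 k) (pc k).
exists (\matrix_(k, j) (p k / c k * q k j)); last first.
  move=> k; rewrite mxE; under eq_bigr do rewrite mxE mulrCA.
  by rewrite -mulr_sumr divfK ?lt0r_neq0.
split=> [k j|j]; first by rewrite mxE mulr_ge0// divr_ge0// ltW.
rewrite (le_trans _ (q1 j))//; apply: ler_sum => k _.
by rewrite mxE ler_piMl// ler_pdivrMr// mul1r.
Qed.

End Allocations.

(** * The queueing process *)

Section History.
Context {R : realType} {K : nat} {d : measure_display} {T : measurableType d}.
Context {P : probability T R} (X : process K P).

(** The generators are named separately so that <<s history_gen n>> unfolds to [history X n] and the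
    lemmas on generated sigma-algebras apply. *)
Definition history_gen (n : nat) : set (set T) :=
  [set A | exists m k, (m <= n)%N /\
        (g_sigma_algebra_preimage (Q X m k) A \/
         g_sigma_algebra_preimage (alloc X m k) A)].

Lemma history_measurable n : <<s history_gen n >> `<=` @measurable _ T.
Proof.
apply: smallest_sub; first exact: sigma_algebra_measurable.
by move=> A [m [k [_ [] [B mB <-]]]]; exact: measurable_funP.
Qed.

Lemma history_Q n m k (phi : nat -> R) (C : R) : (m <= n)%N ->
  (forall w, `|phi (Q X m k w)| <= C) ->
  bounded_meas_wrt (history_gen n) (fun w => phi (Q X m k w)).
Proof.
move=> mn hC; split; last by exists C.
move=> _ B mB; apply: sub_sigma_algebra; exists m, k; split=> //; left.
by exists (phi @^-1` B).
Qed.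

Lemma history_busy n m k : (m <= n)%N ->
  bounded_meas_wrt (history_gen n) (fun w => (0 < Q X m k w)%N%:R : R).
Proof.
move=> mn; apply: (history_Q (phi := fun q => (0 < q)%N%:R) (C := 1)) => // w.
by rewrite normr_nat lern1 leq_b1.
Qed.

Lemma history_alloc n m k (C : R) : (m <= n)%N ->
  (forall w, `|alloc X m k w| <= C) ->
  bounded_meas_wrt (history_gen n) (fun w => alloc X m k w).
Proof.
move=> mn hC; split; last by exists C.
move=> _ B mB; apply: sub_sigma_algebra; exists m, k; split=> //; right.
by exists B.
Qed.

Lemma event_measurable (f : {RV P >-> bool}) : measurable [set w | f w].
Proof.
have mf : measurable_fun setT f by exact: measurable_funP.
by have := mf measurableT [set true] I; rewrite setTI.
Qed.

End History.

Lemma is_cond_prob_setT {R : realType} {d : measure_display}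
    {T : measurableType d} (P : probability T R) (G : set (set T)) :
  <<s G >> `<=` @measurable _ T -> is_cond_prob P <<s G >> setT (cst 1).
Proof.
move=> sG; split.
- move=> B _; rewrite preimage_cst; case: ifP => _.
    exact: (@measurableT _ (g_sigma_algebraType G)).
  exact: (@measurable0 _ (g_sigma_algebraType G)).
- exact/bounded_meas_integrable/bounded_meas_cst.
- by move=> H /sG mH; have := integral_cst P mH 1%E; rewrite mul1e setTI.
Qed.

(** * Conditional mean of the queue increments *)

Section Drift.
Context {R : realType} {K J : nat} {d : measure_display}.
Context {T : measurableType d} {P : probability T R} (N : network R K J).
Context (X : process K P) (lambda : 'cV[R]_K).
Hypotheses (hQ : queue_dynamics X) (hlaw : step_law N X lambda)
  (halloc : forall n w, alloc_set N (allocv X n w)).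

Let Abar := \sum_j alpha N j.

Let busy n k w : R := (0 < Q X n k w)%N%:R.

(** This is the conditional mean of the number of departures given the history. *)
Definition served n k w : R := busy n k w * (mu N k * alloc X n k w).

Definition increment n k w : R := (Q X n.+1 k w)%:R - (Q X n k w)%:R.

Lemma alloc_bounds n k w : 0 <= alloc X n k w <= Abar.
Proof. by have := alloc_set_bounds (halloc n w) k; rewrite mxE. Qed.

Lemma alloc_norm_le n k w : `|alloc X n k w| <= Abar.
Proof. by have /andP[h1 h2] := alloc_bounds n k w; rewrite ger0_norm. Qed.

Lemma incrementE n k w : increment n k w = (arrival X n k w)%:R +
  \sum_i (busy n i w * (service X n i w && route X n i k w)%:R) -
  busy n k w * (service X n k w)%:R.
Proof.
have [_ _ /(_ n k w) /(congr1 (fun z : int => z%:~R : R))] := hQ.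
rewrite /increment /departure !rmorphB !rmorphD/= rmorph_sum/= -!pmulrn => ->.
rewrite /busy -natrM mulnb andbC.
under eq_bigr do rewrite -pmulrn mulnb andbAC andbC -mulnb natrM.
ring.
Qed.

Lemma increment_norm_le n k w : `|increment n k w| <= K%:R + 1.
Proof.
have b01 (b : bool) : 0 <= (b%:R : R) <= 1 by rewrite ler0n lern1 leq_b1.
rewrite incrementE.
have S0 : 0 <= \sum_i (busy n i w * (service X n i w && route X n i k w)%:R).
  by apply: sumr_ge0 => i _; rewrite mulr_ge0.
have S1 : \sum_i (busy n i w * (service X n i w && route X n i k w)%:R) <= K%:R.
  have -> : K%:R = \sum_(i < K) (1 : R) by rewrite sumr_const card_ord.
  by apply: ler_sum => i _; rewrite /busy -natrM mulnb lern1 leq_b1.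
have := b01 (arrival X n k w); rewrite /busy -natrM mulnb.
have := b01 ((0 < Q X n k w)%N && service X n k w).
move=> /andP[? ?] /andP[? ?]; rewrite ler_norml; lra.
Qed.

(** The initial value is deterministic and the increments are bounded. The bound may grow with [n];
    it serves only to make each queue length a bounded variable. *)
Lemma queue_bounded n k : exists C, forall w, `|(Q X n k w)%:R : R| <= C.
Proof.
elim: n => [|n [C hC]].
  have [/(_ k)[q0 h0] _ _] := hQ; exists q0%:R => w.
  by rewrite h0 normr_nat.
exists (C + (K%:R + 1)) => w.
have -> : (Q X n.+1 k w)%:R = (Q X n k w)%:R + increment n k w :> R.
  by rewrite /increment addrC subrK.
by rewrite (le_trans (ler_normD _ _))// lerD// increment_norm_le.
Qed.

Lemma history_increment n m k : (m < n)%N ->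
  bounded_meas_wrt (history_gen X n) (increment m k).
Proof.
move=> mn; have [C hC] := queue_bounded m.+1 k.
have [D hD] := queue_bounded m k.
by apply: bounded_measB;
  [apply: history_Q mn hC|apply: history_Q (ltnW mn) hD].
Qed.

Lemma history_served n m k : (m <= n)%N ->
  bounded_meas_wrt (history_gen X n) (served m k).
Proof.
move=> mn; apply: bounded_measM; first exact: history_busy.
apply: bounded_measZ; apply: history_alloc => // w; exact: alloc_norm_le.
Qed.

Let sub := @history_measurable _ _ _ _ _ X.

Lemma cond_prob_service_route n i k : is_cond_prob P (history X n)
  [set w | service X n i w && route X n i k w]
  (fun w => mu N i * alloc X n i w * routing N i k).
Proof.
have [indep _ hs hr] := hlaw n.
(* Conditional independence is applied with the sure event, of conditional probability 1, at every
   index except the service of [i] and the routing out of [i]. *)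
pose A (s : 'I_K + 'I_K + 'I_K) : set T := match s with
  | inl (inl _) => setT
  | inl (inr j) => if j == i then [set w | service X n i w] else setT
  | inr j => if j == i then [set w | route X n i k w] else setT end.
pose Y (s : 'I_K + 'I_K + 'I_K) : T -> R := match s with
  | inl (inl _) => cst 1
  | inl (inr j) =>
      if j == i then (fun w => mu N i * alloc X n i w) else cst 1
  | inr j => if j == i then cst (routing N i k) else cst 1 end.
have hA s : step_sigma X n s (A s).
  have pT (f : {RV P >-> bool}) : g_sigma_algebra_preimage f setT.
    by exists setT => //; rewrite preimage_setT setTI.
  have pf (f : {RV P >-> bool}) : g_sigma_algebra_preimage f [set w | f w].
    by exists [set true] => //; rewrite setTI.
  case: s => [[j|j]|j] /=; first exact: pT.
    by case: eqVneq => [->|_]; [exact: pf|exact: pT].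
  case: eqVneq => [->|_]; last first.
    exact: (@measurableT _ (g_sigma_algebraType _)).
  by apply: sub_sigma_algebra; exists k => //; exact: pf.
have hY s : is_cond_prob P (history X n) (A s) (Y s).
  have hT := is_cond_prob_setT P (@sub n).
  case: s => [[j|j]|j] /=; first exact: hT.
    by case: eqVneq => _; [exact: hs|exact: hT].
  by case: eqVneq => _; [exact: hr|exact: hT].
have := indep A Y hA hY.
have -> : \bigcap_s A s = [set w | service X n i w && route X n i k w].
  apply/seteqP; split => w /=.
    move=> h; have := h (inl (inr i)) I; have := h (inr i) I.
    by rewrite /= eqxx /= => -> ->.
  move=> /andP[h1 h2] [[j|j]|j] _ //=; first by case: eqVneq.
  by case: eqVneq.
congr is_cond_prob; apply/funext => w.
rewrite (bigD1 (inl (inr i)))//= (bigD1 (inr i))//= eqxx big1 ?mulr1 ?eqxx//.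
by move=> [[j|j]|j] //= ji; case: (eqVneq j i) ji => [->|//];
  rewrite eqxx ?andbF.
Qed.

(** The difference is a sum of event indicators minus their conditional probabilities, with
    coefficients (the busy indicators) known from the history. *)
Lemma increment_drift n k : cond_mean0 P (history_gen X n)
  (fun w => increment n k w -
    (lambda k 0 + \sum_i routing N i k * served n i w - served n k w)).
Proof.
have [_ ha hs _] := hlaw n.
have -> : (fun w => increment n k w -
    (lambda k 0 + \sum_i routing N i k * served n i w - served n k w)) =
  (fun w => (\1_[set w | arrival X n k w] w - lambda k 0) +
    (\sum_i (busy n i w * (\1_[set w | service X n i w && route X n i k w] w -
      mu N i * alloc X n i w * routing N i k)) -
     busy n k w * (\1_[set w | service X n k w] w - mu N k * alloc X n k w))).
  apply/funext => w; rewrite incrementE !indicE !mem_setE /served.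
  under [in RHS]eq_bigr do rewrite indicE mem_setE mulrBr.
  rewrite sumrB.
  have -> : \sum_i routing N i k * (busy n i w * (mu N i * alloc X n i w)) =
    \sum_i busy n i w * (mu N i * alloc X n i w * routing N i k).
    by apply: eq_bigr => i _; ring.
  ring.
have hmu i w : `|mu N i * alloc X n i w| <= mu N i * Abar.
  by rewrite normrM gtr0_norm ?mu_gt0// ler_pM2l ?mu_gt0// alloc_norm_le.
apply: cond_mean0D; first exact: sub.
  by apply: (cond_mean0_cond_prob (@sub n) (C := `|lambda k 0|)
    (event_measurable _) (ha k)).
apply: cond_mean0B; first exact: sub.
  apply: cond_mean0_sum; first exact: sub.
  move=> i; apply: cond_mean0M; [exact: sub|exact: history_busy|].
  apply: (cond_mean0_cond_prob (@sub n)
    (C := mu N i * Abar * `|routing N i k|) _ (cond_prob_service_route n i k)).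
    rewrite (_ : [set w | _] = [set w | service X n i w] `&`
       [set w | route X n i k w]).
      by apply: measurableI; exact: event_measurable.
    by apply/seteqP; split => w /= /andP.
  by move=> w; rewrite normrM ler_wpM2r.
apply: cond_mean0M; [exact: sub|exact: history_busy|].
exact: (cond_mean0_cond_prob (@sub n) (event_measurable _) (hs k) (hmu k)).
Qed.

End Drift.

(** * Lyapunov argument and rate stability *)

Section Stability.
Context {R : realType} {K J : nat} {d : measure_display}.
Context {T : measurableType d} {P : probability T R} (N : network R K J).
Context (X : process K P) (lambda : 'cV[R]_K) (beta : nat -> R) (eps0 : R).
Hypotheses (heps0 : 0 < eps0)
  (hnueps0 : forall k, eps0 <= nominal N lambda k 0 / mu N k)
  (hbeta : step_sizes beta) (hQ : queue_dynamics X)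
  (hlaw : step_law N X lambda) (hp : scheduling N X beta eps0)
  (hcap : capacity_region N lambda).

Let nu k := nominal N lambda k 0.
Let G := invmx (1%:M - (routing N)^T).
Let busy n k w : R := (0 < Q X n k w)%N%:R.
Let Abar := \sum_j alpha N j.

Lemma scheduling_alloc n w : alloc_set N (allocv X n w).
Proof.
have [[p0 hp0 h0] hS] := hp.
by case: n => [|n]; [rewrite h0|have [[]] := hS n w].
Qed.

Let alloc_le := alloc_norm_le scheduling_alloc.

(** This is the increment of the workload (1 - R^T)^-1 Q. Its conditional mean is
    [nu k - served N X n k w], which makes [noise] a martingale difference. *)
Definition drift n k w : R := \sum_i G k i * increment X n i w.

Definition noise n k w : R := drift n k w - (nu k - served N X n k w).

Definition excess n k w : R := alloc X n k w - nu k / mu N k.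

Lemma busy_sqr n k w : busy n k w ^+ 2 = busy n k w.
Proof. by rewrite /busy; case: (0 < _)%N; rewrite ?expr1n ?expr0n. Qed.

Lemma busy_ge0 n k w : 0 <= busy n k w. Proof. exact: ler0n. Qed.

(** With D the vector of served rates, the mean increment is lambda - (1 - R^T) D, and [G] maps it
    to nu - D. *)
Lemma noiseE n k w : noise n k w = \sum_i G k i * (increment X n i w -
  (lambda i 0 + \sum_j routing N j i * served N X n j w - served N X n i w)).
Proof.
pose D := \col_i served N X n i w.
have hD : G *m (D - (routing N)^T *m D) = D.
  rewrite -{1}[D]mul1mx -mulmxBl mulmxA mulVmx ?mul1mx//.
  exact: routing_open.
have hDk : (G *m (D - (routing N)^T *m D)) k 0 = served N X n k w.
  by rewrite hD mxE.
rewrite /noise /drift -hDk /nu /nominal [X in _ - (X - _)]mxE -/G mxE -!sumrB.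
apply: eq_bigr => i _; rewrite !mxE.
under [in LHS]eq_bigr do rewrite !mxE.
ring.
Qed.

Lemma noise_mean0 n k : cond_mean0 P (history_gen X n) (noise n k).
Proof.
have -> : noise n k = fun w => \sum_i G k i * (increment X n i w -
  (lambda i 0 + \sum_j routing N j i * served N X n j w - served N X n i w)).
  by apply/funext => w; exact: noiseE.
apply: cond_mean0_sum => [|i]; first exact: history_measurable.
apply: cond_mean0Z; first exact: history_measurable.
exact: increment_drift hQ hlaw scheduling_alloc n i.
Qed.

Lemma drift_norm_le n k w :
  `|drift n k w| <= \sum_i `|G k i| * (K%:R + 1).
Proof.
rewrite (le_trans (ler_norm_sum _ _ _))//; apply: ler_sum => i _.
by rewrite normrM ler_wpM2l// increment_norm_le.
Qed.

Lemma noise_norm_le n k w : `|noise n k w| <=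
  \sum_i `|G k i| * (K%:R + 1) + (`|nu k| + mu N k * Abar).
Proof.
rewrite (le_trans (ler_normB _ _))// lerD ?drift_norm_le//.
rewrite (le_trans (ler_normB _ _))// lerD//.
have mu0 := mu_gt0 N k.
rewrite /served !normrM (gtr0_norm mu0) (@le_trans _ _ (1 * (mu N k * Abar)))//.
  apply: ler_pM => //; first by rewrite mulr_ge0// ltW.
    by rewrite normr_nat lern1 leq_b1.
  by rewrite ler_pM2l.
by rewrite mul1r.
Qed.

Lemma history_drift n m k : (m < n)%N ->
  bounded_meas_wrt (history_gen X n) (drift m k).
Proof.
move=> mn; apply: bounded_meas_sum => i; apply: bounded_measZ.
exact: history_increment.
Qed.

Lemma history_noise n m k : (m < n)%N ->
  bounded_meas_wrt (history_gen X n) (noise m k).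
Proof.
move=> mn; apply: bounded_measB; first exact: history_drift.
apply: bounded_measB; first exact: bounded_meas_cst.
exact: (history_served scheduling_alloc k (ltnW mn)).
Qed.

Lemma history_excess n k : bounded_meas_wrt (history_gen X n) (excess n k).
Proof.
apply: bounded_measB; last exact: bounded_meas_cst.
by apply: history_alloc => // w; exact: alloc_le.
Qed.

Lemma noise_sum_sublinear k :
  {ae P, forall w, sublinear (fun n => \sum_(m < n) noise m k w)}.
Proof.
apply: (martingale_sublinear (@history_measurable _ _ _ _ _ X)
  (fun n => noise_mean0 n k) (fun n => noise_norm_le n k)) => n.
apply: bounded_meas_sum => i; exact: history_noise.
Qed.

(** The squared distance to the target allocation nu / mu; [descent] and [cross] are the mean and
    noise parts of its first-order change. *)
Definition lyapunov n w : R := \sum_k excess n k w ^+ 2.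
Definition descent n w : R := \sum_k busy n k w * (mu N k * excess n k w ^+ 2).
Definition cross n w : R := \sum_k busy n k w * excess n k w * noise n k w.

(** On a busy queue nu - mu p = - mu (p - nu / mu), so the mask by [Etilde] leaves a noisy gradient
    step towards the target. *)
Lemma drift_busy n k w : busy n k w * drift n k w =
  busy n k w * (noise n k w - mu N k * excess n k w).
Proof.
rewrite /noise /served /excess /busy; have mu0 := lt0r_neq0 (mu_gt0 N k).
by case: (0 < _)%N => /=; [field|rewrite !mul0r].
Qed.

(** The target lies in the convex set projected onto, so projecting does not increase the distance
    to it; the rest is the expansion of the square. *)
Lemma lyapunov_step n w : lyapunov n.+1 w <= lyapunov n w -
  2 * (beta n * descent n w) + 2 * (beta n * cross n w) +
  beta n ^+ 2 * \sum_k drift n k w ^+ 2.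
Proof.
have [_ hS] := hp.
have := eproj_contract (@alloc_set_ge_segment_closed _ _ _ N eps0) (hS n w)
  (nominal_alloc heps0 hnueps0 hcap).
have -> : \sum_k (allocv X n.+1 w k 0 -
    (\col_k0 (nominal N lambda k0 0 / mu N k0)) k 0) ^+ 2 = lyapunov n.+1 w.
  by apply: eq_bigr => k _; rewrite /excess; congr ((_ - _) ^+ 2); rewrite mxE.
move/le_trans; apply.
rewrite /lyapunov /descent /cross !mulr_sumr -sumrB -!big_split/=.
apply: ler_sum => k _.
have -> : (allocv X n w + beta n *: (Etilde X n w *m
    invmx (1%:M - (routing N)^T) *m deltaQ X n w)) k 0 =
    alloc X n k w + beta n * (busy n k w * drift n k w).
  rewrite 2!mxE [in X in _ + X]mxE -mulmxA /Etilde mul_diag_mx !mxE.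
  congr (_ + _ * (_ * _)); apply: eq_bigr => i _; by rewrite !mxE.
rewrite [X in (_ - X) ^+ 2]mxE -/(nu k).
have -> : (alloc X n k w + beta n * (busy n k w * drift n k w) -
    nu k / mu N k) ^+ 2 = excess n k w ^+ 2 +
    2 * beta n * excess n k w * (busy n k w * drift n k w) +
    beta n ^+ 2 * (busy n k w ^+ 2 * drift n k w ^+ 2).
  by rewrite /excess; ring.
rewrite busy_sqr drift_busy.
have h : busy n k w * drift n k w ^+ 2 <= drift n k w ^+ 2.
  by rewrite ler_piMl ?sqr_ge0// lern1 leq_b1.
have := ler_wpM2l (sqr_ge0 (beta n)) h; lra.
Qed.

Local Notation E f := (\int[P]_w f w).

Let subH := @history_measurable _ _ _ _ _ X.

Lemma excess_meas n k : bounded_meas (excess n k).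
Proof. exact: (bounded_meas_wrtW (@subH n) (history_excess n k)). Qed.

Lemma busy_meas n k : bounded_meas (busy n k).
Proof. by apply: (bounded_meas_wrtW (@subH n)); exact: history_busy. Qed.

Lemma lyapunov_meas n : bounded_meas (lyapunov n).
Proof.
by apply: bounded_meas_sum => k; apply: bounded_measX; exact: excess_meas.
Qed.

Lemma descent_meas n : bounded_meas (descent n).
Proof.
apply: bounded_meas_sum => k; apply: bounded_measM; first exact: busy_meas.
by apply: bounded_measZ; apply: bounded_measX; exact: excess_meas.
Qed.

Lemma cross_mean0 n : cond_mean0 P (history_gen X n) (cross n).
Proof.
apply: cond_mean0_sum => [|k]; first exact: subH.
apply: cond_mean0M; [exact: subH| |exact: noise_mean0].
by apply: bounded_measM; [exact: history_busy|exact: history_excess].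
Qed.

Lemma descent_ge0 n w : 0 <= descent n w.
Proof.
apply: sumr_ge0 => k _; rewrite mulr_ge0 ?busy_ge0// mulr_ge0 ?sqr_ge0//.
by rewrite ltW// mu_gt0.
Qed.

(** In expectation the cross term disappears and the Lyapunov inequality telescopes; its
    second-order terms are summable because the squared step sizes are. *)
Lemma descent_mean_sum :
  exists B, forall n, \sum_(m < n) E (fun w => beta m * descent m w) <= B.
Proof.
pose C := \sum_k (\sum_i `|G k i| * (K%:R + 1)) ^+ 2.
have [b0 _ _ /cvg_seq_bounded[M [_ hM]] _] := hbeta.
pose B := M + 1; have MB : M < B by rewrite ltrDl.
have C0 : 0 <= C by apply: sumr_ge0 => k _; exact: sqr_ge0.
have driftC n w : \sum_k drift n k w ^+ 2 <= C.
  apply: ler_sum => k _; rewrite -real_normK ?num_real// lerXn2r ?nnegrE//.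
    exact: le_trans (normr_ge0 _) (drift_norm_le n k w).
  exact: drift_norm_le.
have step n : E (lyapunov n.+1) + 2 * E (fun w => beta n * descent n w) <=
    E (lyapunov n) + beta n ^+ 2 * C.
  have bV := lyapunov_meas.
  have bD : bounded_meas (fun w => beta n * descent n w).
    exact: bounded_measZ (descent_meas n).
  have bZ : bounded_meas (fun w => beta n * cross n w).
    exact: bounded_measZ (cross_mean0 n).1.
  have EZ : E (fun w => beta n * cross n w) = 0.
    exact: ((cross_mean0 n).2 (fun=> beta n) (bounded_meas_cst _)).
  have b1 := bounded_measZ 2 bD.
  have b2 := bounded_measZ 2 bZ.
  have b3 := bounded_measD (bV n.+1) b1.
  have b4 := bounded_measD (bV n) b2.
  (* The cross term is reinserted through its zero mean, so that the claim follows from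
     [lyapunov_step] by monotonicity of expectation. *)
  rewrite -[leRHS]addr0 -[X in _ <= _ + X](mulr0 2) -EZ addrAC.
  rewrite -(mean_cst P (beta n ^+ 2 * C)) -!meanZ// -!meanD//; first last.
    exact: bounded_meas_cst.
  apply: mean_le => //; first exact/bounded_measD/bounded_meas_cst.
  move=> w; have := lyapunov_step n w.
  have := ler_wpM2l (sqr_ge0 (beta n)) (driftC n w); lra.
have V0 n : 0 <= E (lyapunov n).
  by apply: Rintegral_ge0 => w _; apply: sumr_ge0 => k _; exact: sqr_ge0.
exists (E (lyapunov 0) + B * C) => n.
have S n' : E (lyapunov n') +
    2 * \sum_(m < n') E (fun w => beta m * descent m w) <=
    E (lyapunov 0) + (\sum_(m < n') beta m ^+ 2) * C.
  elim: n' => [|n' ih]; first by rewrite !big_ord0 mulr0 mul0r.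
  by rewrite !big_ord_recr/=; have := step n'; lra.
have hB' : \sum_(m < n) beta m ^+ 2 <= B.
  rewrite (le_trans (ler_norm _))//; have := hM B MB n I.
  by rewrite /series/= big_mkord.
have S0 : 0 <= \sum_(m < n) E (fun w => beta m * descent m w).
  apply: sumr_ge0 => m _; apply: Rintegral_ge0 => w _.
  by rewrite mulr_ge0 ?descent_ge0// ltW.
have := S n; have := V0 n; have := ler_wpM2r C0 hB'; lra.
Qed.

Lemma step_size_lb :
  exists2 c, 0 < c & forall n, (0 < n)%N -> 1 <= c * (n%:R * beta n).
Proof.
have [b0 _ _ _ /cvg_seq_bounded[M [_ hM]]] := hbeta.
have c0 : 0 < `|M| + 1 by rewrite ltr_wpDl.
exists (`|M| + 1) => // n n0.
have nb : 0 < n%:R * beta n by rewrite mulr_gt0 ?ltr0n.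
have MB : M < `|M| + 1 by rewrite (le_lt_trans (ler_norm M))// ltrDl.
have := hM _ MB n I; rewrite /= ger0_norm ?invr_ge0 ?(ltW nb)// => h.
by rewrite -ler_pdivrMr// mul1r.
Qed.

(** While queue [k] is busy, this is the amount by which its mean service exceeds [nu k]. *)
Let x k w m : R := busy m k w * (mu N k * excess m k w).

(** The square of [x] is at most [mu N k] times [descent], so its weighted sums are bounded.
    Kronecker's lemma handles the sum of squares, and [sublinear_sum_sqr] passes to the sum
    itself. *)
Lemma excess_sum_sublinear k w B :
  (forall n, \sum_(m < n) beta m * descent m w <= B) ->
  sublinear (fun n => \sum_(m < n) x k w m).
Proof.
move=> hB; have [c c0 hc] := step_size_lb.
have [b0 _ _ _ _] := hbeta.
have mu0 := mu_gt0 N k.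
apply: sublinear_sum_sqr.
apply: (sublinear_sum_weighted (g := fun m => x k w m ^+ 2)
  (B := mu N k * B) c0 hc) => [m|m|n].
- exact: sqr_ge0.
- exact: ltW.
- apply: le_trans (ler_wpM2l (ltW mu0) (hB n)).
  rewrite mulr_sumr; apply: ler_sum => m _.
  rewrite [leRHS]mulrCA; apply: ler_wpM2l; first exact: ltW.
  have -> : x k w m ^+ 2 = mu N k *
      (busy m k w ^+ 2 * (mu N k * excess m k w ^+ 2)) by rewrite /x; ring.
  rewrite busy_sqr ler_pM2l// /descent (bigD1 k)//= lerDl.
  apply: sumr_ge0 => i _; rewrite mulr_ge0 ?busy_ge0// mulr_ge0 ?sqr_ge0//.
  by rewrite ltW// mu_gt0.
Qed.

(* The workload (1 - R^T)^-1 Q is a sublinear term plus nu_k times the idle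
   time of queue k, so that Q solves a Skorokhod reflection problem. *)
Lemma queue_sublinear w :
  (exists B, forall n, \sum_(m < n) beta m * descent m w <= B) ->
  (forall k, sublinear (fun n => \sum_(m < n) noise m k w)) ->
  forall k, sublinear (fun n => (Q X n k w)%:R : R).
Proof.
move=> [B hB] hnoise.
pose U k n : R := \sum_i G k i * (Q X n i w)%:R.
pose Y k n : R := \sum_(m < n) nu k * ((Q X m k w)%:R == 0 :> R)%:R.
pose W k n := U k 0%N +
  (-1 * (\sum_(m < n) x k w m) + \sum_(m < n) noise m k w).
have nu0 k : 0 <= nu k.
  have := lt_le_trans heps0 (hnueps0 k).
  by rewrite pmulr_lgt0 ?invr_gt0 ?mu_gt0//; exact: ltW.
have UE k n : U k n = W k n + Y k n.
  rewrite /W /Y; elim: n => [|n ih]; first by rewrite !big_ord0; ring.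
  have -> : U k n.+1 = U k n + drift n k w.
    rewrite /U /drift -big_split; apply: eq_bigr => i _ /=.
    by rewrite /increment; ring.
  rewrite ih !big_ord_recr/=.
  have -> : drift n k w = noise n k w + nu k - served N X n k w.
    by rewrite /noise; ring.
  (* A busy queue serves at mean rate mu p = x + nu; on an idle one all terms vanish. The missing
     [nu k] of idle steps is what [Y] accumulates. *)
  suff -> : served N X n k w = x k w n +
    nu k * (1 - ((Q X n k w)%:R == 0 :> R)%:R) by ring.
  rewrite /x /served /busy /excess pnatr_eq0 lt0n.
  have mu0 := lt0r_neq0 (mu_gt0 N k).
  by case: eqVneq => _ /=; field.
apply: (reflected_sublinear (routing_ge0 N) (routing_le1 N)
  (routing_open N) nu0 (q := fun k n => (Q X n k w)%:R) (W := W) (Y := Y))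
  => [k|k n|k n|k].
- by rewrite /Y big_ord0.
- by rewrite /Y big_ord_recr.
- rewrite -UE; under eq_bigr do rewrite -UE.
  pose q := \col_i ((Q X n i w)%:R : R).
  (* The reflection equation is obtained by recovering the queue vector from the workload. *)
  have hq : (1%:M - (routing N)^T) *m (G *m q) = q.
    by rewrite mulKVmx//; exact: routing_open.
  have UG i : U i n = (G *m q) i 0.
    by rewrite mxE; apply: eq_bigr => j _; rewrite [q _ _]mxE.
  have -> : (Q X n k w)%:R = q k 0 :> R by rewrite mxE.
  rewrite -[in LHS]hq mulmxBl mul1mx.
  rewrite [LHS]mxE -UG; congr (_ + _); rewrite mxE; congr (- _).
  by rewrite mxE; apply: eq_bigr => i _; rewrite [_^T _ _]mxE -UG.
- apply: sublinearD; first exact: sublinear_cst.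
  by apply: sublinearD => //; apply: sublinearZ; exact: excess_sum_sublinear hB.
Qed.

Lemma scheduling_rate_stable : rate_stable X.
Proof.
have [b0 _ _ _ _] := hbeta; have [B hB] := descent_mean_sum.
have h1 : {ae P, forall w,
    exists B', forall n, \sum_(m < n) beta m * descent m w <= B'}.
  apply: (ae_bounded_sum (f := fun m w => beta m * descent m w) _ _ hB) =>
    [m|m w]; first exact: bounded_measZ (descent_meas m).
  by rewrite mulr_ge0 ?descent_ge0// ltW.
have h2 : {ae P, forall w,
    forall k, sublinear (fun n => \sum_(m < n) noise m k w)}.
  exact: (filter_forall _ noise_sum_sublinear).
move=> k; move: h1 h2; apply: filterS2 => w w1 w2.
exact/sublinear_cvg/queue_sublinear.
Qed.

End Stability.

Theorem theorem4 (R : realType) (K J : nat) (N : network R K J)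
    (lambda : 'cV[R]_K)
    (d : measure_display) (T : measurableType d) (P : probability T R)
    (X : process K P) (beta : nat -> R) (eps0 : R)
    (hlambda01 : forall k, 0 <= lambda k 0 <= 1)
    (hnu : forall k, 0 < nominal N lambda k 0)
    (heps0 : 0 < eps0)
    (hnueps0 : forall k, eps0 <= nominal N lambda k 0 / mu N k)
    (hbeta : step_sizes beta)
    (hQ : queue_dynamics X)
    (hlaw : step_law N X lambda)
    (hp : scheduling N X beta eps0)
    (hcap : capacity_region N lambda) :
  rate_stable X.
Proof. exact: scheduling_rate_stable heps0 hnueps0 hbeta hQ hlaw hp hcap. Qed.
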